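(* Fix a real number $p\in(0,1)$ and an integer $r\geqslant 2$, and let $b=\frac{1}{1-p}$. For each $n$, let $G_n\sim\mathbb{G}(n,p)$. Then $$\mathrm{sat}(G_n,K_{1,r})=\frac{(r-1)n}{2}-\big(1+o(1)\big)(r-1)\log_{b} n$$ with high probability; that is, for every $\epsilon>0$, $$\lim_{n\to\infty}\mathbb{P}\left(\frac{(r-1)n}{2}-(1+\epsilon)(r-1)\log_b n\leqslant \mathrm{sat}(G_n,K_{1,r})\leqslant \frac{(r-1)n}{2}-(1-\epsilon)(r-1)\log_b n\right)=1.$$
   Context: $\mathbb{G}(n,p)$ denotes the Erdős–Rényi random graph: the probability space of all simple graphs on a fixed vertex set of size $n$ in which each pair of distinct vertices is adjacent independently with probability $p$. $K_{1,r}$ is the star graph on $r+1$ vertices. For graphs $G$ and $F$, a spanning subgraph $H$ of $G$ is an $F$-saturated subgraph of $G$ if $H$ contains no subgraph isomorphic to $F$, but for every edge $e\in E(G)\setminus E(H)$ the graph $H+e$ contains a subgraph isomorphic to $F$. $\mathrm{sat}(G,F)$ denotes the minimum number of edges of an $F$-saturated subgraph of $G$. *)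

(* Defs.v *)
From HB Require Import structures.
From mathcomp Require Import all_boot.

Set Implicit Arguments.
Unset Strict Implicit.
Unset Printing Implicit Defensive.

Section SimpleGraphs.
Local Open Scope nat_scope.

Definition pairs (V : finType) : {set {set V}} := [set e : {set V} | #|e| == 2].

Record sgraph (V : finType) : Type :=
  SGraph { edges : {set {set V}}; edges_pairs : edges \subset pairs V }.

HB.instance Definition _ (V : finType) := [isSub for @edges V].
HB.instance Definition _ (V : finType) := [Finite of sgraph V by <:].

(* Elements of E that are not two-element sets are dropped. *)
Definition graph_of (V : finType) (E : {set {set V}}) : sgraph V :=
  SGraph (subsetIr E (pairs V)).

Definition add_edge (V : finType) (H : sgraph V) (e : {set V}) : sgraph V :=
  graph_of (e |: edges H).

(* H has a (not necessarily induced) subgraph isomorphic to F. *)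
Definition contains (V W : finType) (H : sgraph V) (F : sgraph W) : bool :=
  [exists f : {ffun W -> V},
    injectiveb f && [forall e in edges F, f @: e \in edges H]].

Definition saturated (V W : finType) (G : sgraph V) (F : sgraph W)
    (H : sgraph V) : bool :=
  [&& edges H \subset edges G, ~~ contains H F &
      [forall e in edges G :\: edges H, contains (add_edge H e) F]].

(* A subgraph of G has at most #|edges G| edges, so the initial value of the
   iterated minimum does not affect it as soon as some H is F-saturated in G;
   see satP and saturated_exists. *)
Definition sat (V W : finType) (G : sgraph V) (F : sgraph W) : nat :=
  \big[minn/#|edges G|]_(H : sgraph V | saturated G F H) #|edges H|.

(* K_{1,r}: the centre is ord0. *)
Definition star (r : nat) : sgraph 'I_r.+1 :=
  graph_of [set [set ord0; i] | i : 'I_r.+1 in predC1 ord0].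

Lemma card_star (r : nat) : #|edges (star r)| = r.
Proof.
have -> : edges (star r)
    = [set [set ord0; i] | i : 'I_r.+1 in predC1 ord0].
  apply/setIidPl/subsetP => _ /imsetP[i i0 ->].
  by rewrite inE cards2; move: i0; rewrite inE /= eq_sym => ->.
rewrite card_in_imset; first by rewrite cardC1 card_ord.
move=> i j; rewrite !inE /= => i0 _ eij.
have : i \in [set ord0; j] by rewrite -eij set22.
by rewrite !inE (negbTE i0) => /eqP.
Qed.

Lemma satP (V W : finType) (G : sgraph V) (F : sgraph W) :
  (exists H, saturated G F H) ->
  (exists2 H, saturated G F H & #|edges H| = sat G F) /\
  (forall H, saturated G F H -> sat G F <= #|edges H|).
Proof.
move=> [H0 satH0].
have sat_le H : saturated G F H -> sat G F <= #|edges H|.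
  move=> sH; rewrite /sat; have := mem_index_enum H.
  elim: (index_enum _) => // H' s IHs; rewrite inE big_cons.
  case/predU1P => [<-|/IHs le_s]; first by rewrite sH geq_minl.
  by case: ifP => // _; rewrite geq_min le_s orbT.
split=> //.
have [[H sH eH]|eG] : (exists2 H, saturated G F H & #|edges H| = sat G F)
    \/ sat G F = #|edges G|.
- rewrite /sat; elim/big_ind: _ => [|x y|H sH].
  + by right.
  + by case: (leqP x y).
  + by left; exists H.
- by exists H.
- exists H0 => //; apply/eqP; rewrite eqn_leq sat_le // eG andbT.
  by case/and3P: satH0 => sHG _ _; exact: subset_leq_card.
Qed.

Lemma saturated_exists (V W : finType) (G : sgraph V) (F : sgraph W) :
  0 < #|edges F| -> exists H, saturated G F H.
Proof.
move=> /card_gt0P [e0 e0F].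
pose P := [pred H : sgraph V | (edges H \subset edges G) && ~~ contains H F].
have P0 : P (graph_of set0).
  rewrite /= set0I sub0set /=; apply/existsP=> -[f /andP[_ /forall_inP]].
  by move=> /(_ _ e0F); rewrite /= set0I inE.
case: (arg_maxnP (fun H : sgraph V => #|edges H|) P0) => H /andP[HG HF] maxH.
exists H; apply/and3P; split=> //.
apply/forall_inP => e; rewrite inE => /andP[eH eG].
apply: contraNT eH => nc.
have ee : edges (add_edge H e) = (e |: edges H).
  apply/setIidPl; rewrite subUset edges_pairs sub1set andbT.
  exact: (subsetP (edges_pairs G)).
have PA : P (add_edge H e).
  by apply/andP; split=> //; rewrite ee subUset sub1set eG.
have := maxH _ PA; rewrite ee cardsU1.
by case: (e \in edges H) => //=; rewrite add1n ltnn.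
Qed.

End SimpleGraphs.

From mathcomp Require Import all_order all_algebra.
From mathcomp Require Import all_classical all_reals all_analysis.
Import Order.TTheory GRing.Theory Num.Theory.

Section RandomGraph.
Local Open Scope ring_scope.

(* The mass of G in the Erdos-Renyi space G(n,p). *)
Definition er_weight (R : realType) (p : R) (n : nat) (G : sgraph 'I_n) : R :=
  \prod_(e in pairs 'I_n) (if e \in edges G then p else 1 - p).

Definition er_prob (R : realType) (p : R) (n : nat) (A : pred (sgraph 'I_n)) : R :=
  \sum_(G : sgraph 'I_n | A G) er_weight p G.

Definition log_base (R : realType) (b x : R) : R := ln x / ln b.

Lemma er_prob_total (R : realType) (p : R) (n : nat) :
  er_prob p (fun _ : sgraph 'I_n => true) = 1.
Proof.
rewrite /er_prob /er_weight.
rewrite (reindex_onto (@graph_of _) (@edges _)) /=; last first.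
  by move=> G _; apply/val_inj/finset.setIidPl/edges_pairs.
pose F (e : {set 'I_n}) := if e \in pairs 'I_n then p else 0.
pose F' (e : {set 'I_n}) := if e \in pairs 'I_n then 1 - p else 1.
have FF' : \prod_(e : {set 'I_n}) (F e + F' e) = 1 :> R.
  rewrite big1 // => e _; rewrite /F /F'.
  by case: ifP => _; rewrite ?add0r // addrC subrK.
rewrite -[RHS]FF' finset.bigA_distr [LHS]big_mkcond; apply: eq_big => //= E _.
case: eqP => [EE|/eqP EE].
  have /fintype.subsetP sE : E \subset pairs 'I_n.
    by rewrite -EE; exact: finset.subsetIr.
  rewrite [LHS]big_mkcond; apply: eq_big => //= e _.
  rewrite EE /F /F'; case: ifP => // /negbT ne.
  by rewrite ifN //; apply: contra ne; exact: sE.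
have /fintype.subsetPn[e eE ne] : ~~ (E \subset pairs 'I_n).
  by apply: contra EE => /finset.setIidPl ->.
by rewrite (bigD1 e) //= eE /F (negbTE ne) mul0r.
Qed.

End RandomGraph.

(* Main.v *)
Require Import Defs.
From mathcomp Require Import all_boot zify.

(* Write d = r - 1. A subgraph H of G is K_{1,r}-saturated iff its degrees are at
   most d and every edge of G inside the set S of vertices of H-degree < d is an
   edge of H; in particular G[S] has maximum degree < d.

   Lower bound: a union bound shows that whp every set of maximum induced degree
   < d has fewer than (2 + o(1)) log_b n vertices, so |S| is that small, and
   2|E(H)| >= d (n - |S|).

   Upper bound: by the second moment method, applied to the transversals of a
   partition of the vertices into k blocks, whp G has an independent set I of
   size k = (2 - o(1)) log_b n. Choose H0 avoiding I, of maximum degree at most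
   d, with as many edges as possible. Since whp the minimum degree of G is much
   larger than log n and any two disjoint sets of 3 log_b n vertices are joined
   by an edge, a switch along an alternating path of length five shows that at
   most one vertex outside I has H0-degree < d. Extending H0 to a saturated graph
   adds at most d edges at I, so 2|E(H)| <= d (n - k) + d. *)

Set Implicit Arguments.
Unset Strict Implicit.
Unset Printing Implicit Defensive.

(** * Degrees and star-saturation *)

Section Degrees.
Variable V : finType.
Implicit Types (E : {set {set V}}) (G H : sgraph V) (u v w x y : V).

Definition deg E v := #|[set e in E | v \in e]|.

Definition nbs E v := [set w | [set v; w] \in E].

Lemma deg_setU1 E e w : e \notin E -> deg (e |: E) w = deg E w + (w \in e).
Proof.
move=> eE; rewrite /deg; case: (boolP (w \in e)) => we.
  rewrite addn1 (_ : [set _ in _ | _] = e |: [set f in E | w \in f]).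
    by rewrite cardsU1 inE (negbTE eE).
  by apply/setP => f; rewrite !inE; case: eqP => // ->; rewrite we.
rewrite addn0; congr #|pred_of_set _|; apply/setP => f; rewrite !inE.
by case: eqP => // ->; rewrite (negbTE we) !andbF.
Qed.

Lemma deg_setD1 E e w : e \in E -> deg (E :\ e) w + (w \in e) = deg E w.
Proof. by move=> eE; rewrite -[E in RHS](setD1K eE) deg_setU1 // setD11. Qed.

Lemma deg_sub E E' w : E \subset E' -> deg E w <= deg E' w.
Proof.
move=> /subsetP sE; apply/subset_leq_card/subsetP => e.
by rewrite !inE => /andP[/sE-> ->].
Qed.

Lemma sum_deg E : E \subset pairs V -> \sum_v deg E v = 2 * #|E|.
Proof.
move=> /subsetP EP; rewrite /deg.
under eq_bigr do rewrite -sum1dep_card big_mkcondr.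
rewrite exchange_big /= -sum1_card big_distrr /=; apply: eq_bigr => e /EP.
rewrite inE => /eqP <-; rewrite muln1 -sum1_card [RHS]big_mkcond.
by apply: eq_bigr.
Qed.

Lemma pairs_set2 v w : ([set v; w] \in pairs V) = (v != w).
Proof. by rewrite inE cards2 eqSS eqb1. Qed.

Lemma edge_neq G v w : [set v; w] \in edges G -> v != w.
Proof. by move=> /(subsetP (edges_pairs G)); rewrite pairs_set2. Qed.

Lemma edgeP G e v : e \in edges G -> v \in e -> exists2 w, v != w & e = [set v; w].
Proof.
move=> eG ve; have := subsetP (edges_pairs G) _ eG.
rewrite inE => /cards2P[a [b [ab eE]]]; move: ve; rewrite eE !inE.
by case/orP => /eqP->; [exists b|exists a; rewrite 1?eq_sym// setUC].
Qed.

Lemma nbsC E v w : (w \in nbs E v) = (v \in nbs E w).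
Proof. by rewrite !inE setUC. Qed.

Lemma card_nbs G v : #|nbs (edges G) v| = deg (edges G) v.
Proof.
have inj : {in nbs (edges G) v &, injective (fun w => [set v; w])}.
  move=> w w'; rewrite !inE => /edge_neq vw _ eww.
  have : w \in [set v; w'] by rewrite -eww set22.
  by rewrite !inE eq_sym (negbTE vw) => /eqP.
rewrite -(card_in_imset inj) /deg; congr #|pred_of_set _|; apply/setP => e.
rewrite inE; apply/imsetP/andP => [[w + ->]|[eG ve]].
  by rewrite inE set21 => ->.
by have [w _ eE] := edgeP eG ve; exists w => //; rewrite inE -eE.
Qed.

Lemma mem_set2_nat v w z : v != w -> (z \in [set v; w] : nat) = (z == v) + (z == w).
Proof. by move=> vw; rewrite !inE; do 2![case: eqP => // ?]; subst; rewrite eqxx in vw. Qed.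

Lemma add_edgeE H e : e \in pairs V -> edges (add_edge H e) = e |: edges H.
Proof. by move=> eP; apply/setIidPl; rewrite subUset sub1set eP edges_pairs. Qed.

(** The images of the [r] leaves are distinct neighbours of the image of the centre; conversely, an
    enumeration of the neighbours of [v] embeds the star. *)
Lemma contains_star H r : contains H (star r) = [exists v, r <= deg (edges H) v].
Proof.
have memstar (i : 'I_r.+1) : i != ord0 -> [set ord0; i] \in edges (star r).
  move=> i0; rewrite 2!inE cards2 eqSS eqb1 [ord0 == _]eq_sym i0 andbT; apply/imsetP.
  by exists i => //; rewrite !inE.
apply/existsP/existsP => [[f /andP[/injectiveP fI /forall_inP fE]]|[v]].
  exists (f ord0); rewrite -card_nbs.
  rewrite -[leqLHS](_ : #|f @: predC1 ord0| = r); last first.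
    by rewrite card_imset// cardC1 card_ord.
  apply/subset_leq_card/subsetP => _ /imsetP[i i0 ->].
  by have := fE _ (memstar i i0); rewrite imsetU1 imset_set1 inE.
rewrite -card_nbs => rv; set s := enum (nbs (edges H) v).
have ss : r <= size s by rewrite -cardE.
pose f := [ffun i : 'I_r.+1 => if i == ord0 then v else nth v s i.-1].
have fs (i : 'I_r.+1) : i != ord0 -> i.-1 < size s.
  by case: i => [[|i] ilt]//= _; apply: leq_trans ss.
have fnb (i : 'I_r.+1) : i != ord0 -> f i \in nbs (edges H) v.
  by move=> i0; rewrite ffunE (negbTE i0) -mem_enum mem_nth// fs.
have fv (i : 'I_r.+1) : i != ord0 -> v != f i.
  by move=> /fnb; rewrite inE => /edge_neq.
exists f; apply/andP; split.
  apply/injectiveP => i j.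
  case: (eqVneq i ord0) => [->|i0]; case: (eqVneq j ord0) => [->|j0] //.
  - by move=> /eqP; rewrite {1}ffunE eqxx (negbTE (fv _ j0)).
  - by move=> /esym/eqP; rewrite {1}ffunE eqxx (negbTE (fv _ i0)).
  rewrite !ffunE (negbTE i0) (negbTE j0) => /eqP.
  rewrite nth_uniq ?fs ?enum_uniq// => /eqP eij; apply: val_inj => /=.
  by move: i0 j0 eij; case: i j => [[|i] ?] [[|j] ?] //= _ _ ->.
apply/forall_inP => e; rewrite inE => /andP[/imsetP[i i0 ->] _].
have {}i0 : i != ord0 by [].
rewrite imsetU1 imset_set1.
by have := fnb _ i0; rewrite inE [f ord0]ffunE eqxx.
Qed.

(** In a graph of maximum degree at most [d], a new edge raises only the degrees of its two ends, so
    it completes a star with [d.+1] leaves exactly when one end already has degree [d]. *)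
Lemma saturated_starP G H d :
  reflect [/\ edges H \subset edges G, forall v, deg (edges H) v <= d &
    forall v w, [set v; w] \in edges G -> deg (edges H) v < d ->
      deg (edges H) w < d -> [set v; w] \in edges H]
  (saturated G (star d.+1) H).
Proof.
rewrite /saturated contains_star negb_exists.
apply: (iffP and3P) => -[HG Hd Hs]; split=> //.
- by move=> v; rewrite leqNgt; move/forallP: Hd => /(_ v).
- move=> v w vwG vd wd; apply: contraT => vwH.
  have eGH : [set v; w] \in edges G :\: edges H by rewrite !inE vwH.
  have vwP := subsetP (edges_pairs G) _ vwG.
  move/forall_inP: Hs => /(_ _ eGH); rewrite contains_star => /existsP[z].
  rewrite add_edgeE// deg_setU1// inE.
  move/forallP: Hd => /(_ z); rewrite !inE -leqNgt => zd.
  case: eqP => [->|_]/=; first by move: vd; lia.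
  by case: eqP => [->|_]/=; [move: wd|]; lia.
- by apply/forallP => v; rewrite -leqNgt.
- apply/forall_inP => e; rewrite inE => /andP[eH eG].
  rewrite contains_star add_edgeE ?(subsetP (edges_pairs G))//.
  have := subsetP (edges_pairs G) _ eG.
  rewrite inE => /cards2P[v [w [vw eE]]]; apply/existsP.
  have [vd|vd] := ltnP (deg (edges H) v) d; last first.
    by exists v; rewrite deg_setU1// eE set21 addn1 ltnS.
  have [wd|wd] := ltnP (deg (edges H) w) d; last first.
    by exists w; rewrite deg_setU1// eE set22 addn1 ltnS.
  by move: eH; rewrite eE Hs// -eE.
Qed.

Lemma exists_subset_card (S : {set V}) s :
  s <= #|S| -> exists2 A : {set V}, A \subset S & #|A| = s.
Proof.
rewrite -bin_gt0 -cards_draws => /card_gt0P[A].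
by rewrite inE => /andP[? /eqP]; exists A.
Qed.

(** By saturation, the neighbours of [v] in [G] that lie in [S] are neighbours in [H], and [v] has
    fewer than [d] of those. *)
Lemma deficient_induced_deg G H d v : saturated G (star d.+1) H ->
  let S := [set v | deg (edges H) v < d] in
  v \in S -> #|nbs (edges G) v :&: S| < d.
Proof.
move=> /saturated_starP[_ _ Hs] S; rewrite inE => vd.
apply: (leq_ltn_trans _ vd); rewrite -card_nbs; apply/subset_leq_card/subsetP => w.
rewrite !inE => /andP[vwG wd]; apply: Hs => //.
Qed.

(** Fewer than [s] vertices are deficient, since [s] of them would include one with [d] neighbours
    among them. All the others contribute [d] to the degree sum. *)
Lemma saturated_star_card_ge G H d s : saturated G (star d.+1) H ->
  (forall S : {set V}, #|S| = s ->
    exists2 v, v \in S & d <= #|nbs (edges G) v :&: S|) ->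
  d * #|V| <= 2 * #|edges H| + d * s.
Proof.
move=> sH Gs; pose S := [set v | deg (edges H) v < d].
have Ss : #|S| < s.
  rewrite ltnNge; apply/negP => sS.
  have [A AS Ac] := exists_subset_card sS.
  have [v vA] := Gs _ Ac; apply/negP; rewrite -ltnNge.
  apply: leq_ltn_trans (deficient_induced_deg sH (subsetP AS _ vA)).
  by apply/subset_leq_card/setIS.
rewrite -(sum_deg (edges_pairs H)).
apply: (@leq_trans (\sum_v deg (edges H) v + d * #|S|)); last first.
  by rewrite leq_add2l leq_mul2l (ltnW Ss) orbT.
rewrite mulnC -sum_nat_const mulnC -sum_nat_const [X in _ + X]big_mkcond.
rewrite -big_split /=.
by apply: leq_sum => v _; rewrite inE; case: ltnP => vd; rewrite ?addn0 // leq_addl.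
Qed.

End Degrees.

(** * Near-factors avoiding an independent set *)

Section NearFactor.
Variable V : finType.
Implicit Types (E : {set {set V}}) (G H : sgraph V) (I X Y : {set V}).

Lemma set2_eq (a b a' b' : V) : [set a; b] = [set a'; b'] ->
  (a = a' /\ b = b') \/ (a = b' /\ b = a').
Proof.
move=> eq2.
have : a \in [set a'; b'] by rewrite -eq2 set21.
have : b \in [set a'; b'] by rewrite -eq2 set22.
have : a' \in [set a; b] by rewrite eq2 set21.
have : b' \in [set a; b] by rewrite eq2 set22.
by rewrite !inE => /pred2P + /pred2P + /pred2P + /pred2P; intuition congruence.
Qed.

(** Preserves the degree bound both when the edge [uv] is inserted and after a switch: in each case
    only [u] and [v] gain, by one. *)
Lemma leq_add_eq2 (f : V -> nat) d (u v w : V) : u != v -> f u < d -> f v < d ->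
  f w <= d -> f w + ((w == u) + (w == v)) <= d.
Proof.
move=> uv fu fv; case: (eqVneq w u) => [->|_].
  by rewrite (negbTE uv) addn0 addn1.
by case: (eqVneq w v) => [->|_]; rewrite ?addn1 ?addn0.
Qed.

(* Alternating switch: [xx'] and [yy'] leave, [ux], [vy] and [x'y'] enter, so
   that only the degrees of [u] and [v] change. *)
Lemma switch_edges H (u v x x' y y' : V) :
  let E := edges H in
  let E' := [set x'; y'] |: ([set v; y] |: ([set u; x] |:
              (E :\ [set x; x'] :\ [set y; y']))) in
  [set x; x'] \in E -> [set y; y'] \in E ->
  [set u; x] \notin E -> [set v; y] \notin E -> [set x'; y'] \notin E ->
  u != x -> v != y -> x' != y' -> u != v -> x != v ->
  #|E'| = #|E|.+1 /\ forall w, deg E' w = deg E w + (w == u) + (w == v).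
Proof.
move=> E E' xE yE uxE vyE xyE ux vy xy uv xv.
have xx := edge_neq xE; have yy := edge_neq yE.
(* Edges leave and enter one at a time, so each must be shown present or absent at its turn. The
   case [x = y] is allowed. *)
have yE1 : [set y; y'] \in E :\ [set x; x'].
  rewrite !inE yE andbT; apply/eqP => /set2_eq[[? ?]|[? ?]]; subst.
    by rewrite eqxx in xy.
  by move: xyE; rewrite yE.
have uxE2 : [set u; x] \notin E :\ [set x; x'] :\ [set y; y'].
  by apply: contra uxE; rewrite !inE => /and3P[].
have vyE3 : [set v; y] \notin [set u; x] |: (E :\ [set x; x'] :\ [set y; y']).
  rewrite !inE (negbTE vyE) !andbF orbF.
  by apply/eqP => /set2_eq[[? ?]|[? ?]]; subst; rewrite eqxx in uv xv.
have xyE4 : [set x'; y'] \notin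
    [set v; y] |: ([set u; x] |: (E :\ [set x; x'] :\ [set y; y'])).
  rewrite !inE (negbTE xyE) !andbF orbF negb_or.
  apply/andP; split; apply/eqP => /set2_eq[[? ?]|[? ?]]; subst.
  - by rewrite eqxx in yy.
  - by move: vyE; rewrite setUC yE.
  - by move: uxE; rewrite setUC xE.
  - by rewrite eqxx in xx.
split=> [|w].
  rewrite !cardsU1 xyE4 vyE3 uxE2 (cardsD1 [set x; x'] E) xE.
  by rewrite (cardsD1 [set y; y'] (E :\ _)) yE1 !addnA.
rewrite !deg_setU1//.
have := deg_setD1 w xE; have := deg_setD1 w yE1.
by rewrite !mem_set2_nat// => <- <-; move: (deg _ _); do 6!move: (nat_of_bool _); clear; lia.
Qed.

Definition admissible G I d H := [&& edges H \subset edges G,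
  [forall v, deg (edges H) v <= d] & [forall e in edges H, e \subset ~: I]].

(** Were [x] deficient as well, the edge [ux] could be added, against maximality. *)
Lemma admissible_maximal_full G I d H (u x : V) : admissible G I d H ->
  (forall H', admissible G I d H' -> #|edges H'| <= #|edges H|) ->
  u \notin I -> x \notin I -> [set u; x] \in edges G -> [set u; x] \notin edges H ->
  deg (edges H) u < d -> deg (edges H) x = d.
Proof.
move=> /and3P[HG /forallP Hd /forall_inP HI] maxH uI xI uxG uxH ud.
apply/eqP; rewrite eqn_leq Hd leqNgt; apply/negP => xd.
have uxP := subsetP (edges_pairs G) _ uxG.
have: admissible G I d (add_edge H [set u; x]).
  rewrite /admissible add_edgeE// subUset sub1set uxG HG /=.
  apply/andP; split.
    apply/forallP => w; rewrite deg_setU1// mem_set2_nat ?(edge_neq uxG)//.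
    exact: leq_add_eq2 (edge_neq uxG) ud xd (Hd w).
  apply/forall_inP => e; rewrite !inE => /predU1P[->|/HI//].
  by rewrite subUset !sub1set !inE uI.
by move=> /maxH; rewrite add_edgeE// cardsU1 uxH add1n ltnn.
Qed.

Lemma leq_card_bigcup (A : {set V}) (F : V -> {set V}) :
  #|\bigcup_(x in A) F x| <= \sum_(x in A) #|F x|.
Proof.
elim/big_rec2: _ => [|x n B _ leB]; first by rewrite cards0.
by apply: leq_trans (leq_card_setU _ _) _; rewrite leq_add2l.
Qed.

Lemma card_nbs_cover E X Y d : (forall v, #|nbs E v| <= d) ->
  {in X, forall x, exists2 y, y \in nbs E x & y \in Y} -> #|X| <= d * #|Y|.
Proof.
move=> Ed XY; apply: (@leq_trans #|\bigcup_(y in Y) nbs E y|).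
  apply/subset_leq_card/subsetP => x /XY[y yx yY].
  by apply/bigcupP; exists y => //; rewrite nbsC.
apply: leq_trans (leq_card_bigcup _ _) _.
by rewrite mulnC -sum_nat_const; apply: leq_sum.
Qed.

Definition edge_between G k := forall X Y, #|X| = k -> #|Y| = k ->
  [disjoint X & Y] -> exists x y, [/\ x \in X, y \in Y & [set x; y] \in edges G].

(** If [u != v], an alternating path [u x x' y' y v], with [xx'] and [yy'] in [H] and the other
    three edges in [G] but not in [H], gives a switch that gains an edge. Large degrees supply many
    candidates for [x'] and [y'], and [edge_between] joins two of them. *)
Lemma admissible_maximum_deficient G I d k H (u v : V) : 0 < d ->
  edge_between G k ->
  (forall w, d + #|I| + d * ((d + 2) * k) <= #|nbs (edges G) w|) ->
  admissible G I d H ->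
  (forall H', admissible G I d H' -> #|edges H'| <= #|edges H|) ->
  u \notin I -> v \notin I ->
  deg (edges H) u < d -> deg (edges H) v < d -> u = v.
Proof.
move=> d0 Gk Gdeg aH maxH uI vI ud vd; apply/eqP; apply: contraT => uv.
have /and3P[HG /forallP Hd /forall_inP HI] := aH.
pose N w := nbs (edges G) w :\: nbs (edges H) w :\: I.
(* [N w] contains the possible second vertices of a path starting at [w], and [B w] the possible
   third ones. *)
pose B w := [set z | [exists x in N w, z \in nbs (edges H) x]].
have full w x : w \notin I -> deg (edges H) w < d -> x \in N w ->
    deg (edges H) x = d.
  move=> wI wd; rewrite !inE => /and3P[xI xH xG].
  exact: (admissible_maximal_full aH maxH wI xI xG xH wd).
(* Discarding at most [d] neighbours in [H] and the set [I] leaves [d * ((d + 2) * k)] vertices in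
   [N w]. Each has a neighbour in [B w], as its degree is [d > 0], and each vertex of [B w] serves
   at most [d] of them. *)
have cardB w : w \notin I -> deg (edges H) w < d -> (d + 2) * k <= #|B w|.
  move=> wI wd; rewrite -(leq_pmul2l d0); apply: leq_trans (_ : #|N w| <= _).
    have := Gdeg w; have := Hd w; rewrite -card_nbs.
    have := cardsID (nbs (edges H) w) (nbs (edges G) w).
    have := cardsID I (nbs (edges G) w :\: nbs (edges H) w).
    have := subset_leq_card (subsetIr (nbs (edges G) w) (nbs (edges H) w)).
    have := subset_leq_card (subsetIr (nbs (edges G) w :\: nbs (edges H) w) I).
    rewrite -/(N w); lia.
  apply: (@card_nbs_cover (edges H)) => [z|x xN]; first by rewrite card_nbs.
  have: 0 < #|nbs (edges H) x| by rewrite card_nbs (full w).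
  by move=> /card_gt0P[y yx]; exists y => //; rewrite inE; apply/exists_inP; exists x.
have kB w : w \notin I -> deg (edges H) w < d -> k <= #|B w|.
  by move=> wI wd; apply: leq_trans (cardB w wI wd); rewrite leq_pmull// addn2.
have [X XB Xk] := exists_subset_card (kB u uI ud).
(* An edge from [X] to a vertex outside [Z] is not in [H]. As [Z] has at most [(d + 1) * k]
   elements, at least [k] of the [(d + 2) * k] vertices of [B v] remain. *)
pose Z := X :|: \bigcup_(x in X) nbs (edges H) x.
have Zk : #|Z| <= k + k * d.
  apply: leq_trans (leq_card_setU _ _) _; rewrite Xk leq_add2l.
  apply: leq_trans (leq_card_bigcup _ _) _.
  by rewrite -Xk -sum_nat_const; apply: leq_sum => x _; rewrite card_nbs.
have YZ : k <= #|B v :\: Z|.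
  have := cardsID Z (B v); have := subset_leq_card (subsetIr (B v) Z).
  have := cardB v vI vd; lia.
have [Y YB Yk] := exists_subset_card YZ.
have XY : [disjoint X & Y].
  rewrite disjoint_sym disjoint_subset; apply/subsetP => y /(subsetP YB).
  by rewrite !inE negb_or => /andP[/andP[]].
have [x' [y' [xX yY xyG]]] := Gk X Y Xk Yk XY.
have /exists_inP[x xN xx] : [exists x in N u, x' \in nbs (edges H) x].
  by have := subsetP XB _ xX; rewrite inE.
have [yZ yB] : y' \notin Z /\ y' \in B v.
  by have := subsetP YB _ yY; rewrite inE => /andP[].
have /exists_inP[y yN yy] : [exists y in N v, y' \in nbs (edges H) y].
  by move: yB; rewrite inE.
have xyH : [set x'; y'] \notin edges H.
  apply: contra yZ => xyH; rewrite inE; apply/orP; right.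
  by apply/bigcupP; exists x' => //; rewrite inE.
have xd := full u x uI ud xN.
have xv : x != v by apply: contraTneq vd => <-; rewrite xd ltnn.
move: xN yN xx yy; rewrite !inE => /and3P[xI uxH uxG] /and3P[yI vyH vyG] xx yy.
have [] := switch_edges xx yy uxH vyH xyH (edge_neq uxG) (edge_neq vyG)
  (edge_neq xyG) uv xv.
set E' := (_ |: _) => E'card E'deg.
(* Both vertices are ends of edges of [H], which avoid [I]. *)
have xyI : (x' \notin I) && (y' \notin I).
  move: (HI _ xx) (HI _ yy); rewrite !subUset !sub1set !inE.
  by move=> /andP[_ ->] /andP[_ ->].
have E'G : E' \subset edges G.
  rewrite !subUset !sub1set uxG vyG xyG /=.
  by apply: subset_trans HG; do 2!apply: subset_trans (subsetDl _ _) _.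
have E'P := subset_trans E'G (edges_pairs G).
have: admissible G I d (SGraph E'P).
  apply/and3P; split=> //=.
    apply/forallP => w; rewrite E'deg -addnA.
    exact: leq_add_eq2 uv ud vd (Hd w).
  apply/forall_inP => e; rewrite !inE.
  case/or4P => [/eqP->|/eqP->|/eqP->|/and3P[_ _ /HI//]];
    rewrite subUset !sub1set !inE ?xyI ?xI ?yI ?uI ?vI//.
by move=> /maxH /=; rewrite E'card ltnn.
Qed.

(** Take a supergraph of [H] in [G] with the most edges under the degree bound: an edge of [G]
    between two deficient vertices must already be in it. *)
Lemma saturated_star_extension G H d : edges H \subset edges G ->
  (forall v, deg (edges H) v <= d) ->
  exists2 H', saturated G (star d.+1) H' & edges H \subset edges H'.
Proof.
move=> HG Hd.
pose P := [pred H' : sgraph V | [&& edges H \subset edges H',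
  edges H' \subset edges G & [forall v, deg (edges H') v <= d]]].
have PH : P H by rewrite /= subxx HG; apply/forallP.
case: (arg_maxnP (fun H' : sgraph V => #|edges H'|) PH).
move=> H' /and3P[HH' H'G /forallP H'd] maxH; exists H' => //.
apply/saturated_starP; split=> // v w vwG vd wd; apply: contraT => vwH.
have vwP := subsetP (edges_pairs G) _ vwG.
have: P (add_edge H' [set v; w]).
  apply/and3P; rewrite add_edgeE// subUset sub1set vwG; split=> //.
    exact: subset_trans HH' (subsetUr _ _).
  apply/forallP => z; rewrite deg_setU1// mem_set2_nat ?(edge_neq vwG)//.
  exact: leq_add_eq2 (edge_neq vwG) vd wd (H'd z).
by move=> /maxH; rewrite add_edgeE// cardsU1 vwH add1n /= ltnn.
Qed.

(** Vertices outside [I] contribute at most [d] each to the degree sum of the extension [H], and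
    those of [I] at most [d] altogether. *)
Lemma sat_star_le G I d k : 0 < d -> edge_between G k ->
  (forall w, d + #|I| + d * ((d + 2) * k) <= #|nbs (edges G) w|) ->
  {in I &, forall v w, [set v; w] \notin edges G} ->
  2 * sat G (star d.+1) + d * #|I| <= d * #|V| + d.
Proof.
move=> d0 Gk Gdeg indI.
have a0 : admissible G I d (graph_of set0).
  apply/and3P; rewrite /= set0I sub0set; split=> //.
    apply/forallP => v; rewrite /deg (_ : [set _ in _ | _] = set0) ?cards0//.
    by apply/setP => e; rewrite !inE.
  by apply/forall_inP => e; rewrite inE.
case: (arg_maxnP (fun H' : sgraph V => #|edges H'|) a0) => H0 aH maxH.
have uniq_def := admissible_maximum_deficient d0 Gk Gdeg aH maxH.
have /and3P[HG /forallP Hd /forall_inP HI] := aH.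
have [H sH HH] := saturated_star_extension HG Hd.
have /saturated_starP[HsubG Hdeg _] := sH.
have [_ /(_ _ sH) leH] := satP (ex_intro _ H sH).
apply: (@leq_trans (2 * #|edges H| + d * #|I|)); first by rewrite leq_add2r leq_mul2l leH.
(* The edge is not in [H0], so the degree of [w] in [H0] is strictly below its degree in [H], hence
   below [d]. *)
have nbI v w : v \in I -> [set v; w] \in edges H ->
    (w \notin I) && (deg (edges H0) w < d).
  move=> vI vwH; have vwG := subsetP HsubG _ vwH; apply/andP; split.
    by apply/negP => wI; move: (indI _ _ vI wI); rewrite vwG.
  have vwH0 : [set v; w] \notin edges H0.
    by apply/negP => /HI; rewrite subUset !sub1set !inE vI.
  apply: leq_trans (Hdeg w).
  rewrite -[edges H](setD1K vwH) deg_setU1 ?setD11// set22 addn1 ltnS.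
  by apply: deg_sub; rewrite subsetD1 HH.
(* All edges of [H] at [I] end in the unique deficient vertex [u] of [H0] outside [I], so the degree
   of [u] in [H] bounds their number. Without such a vertex there are no such edges. *)
have sumI : \sum_(v in I) deg (edges H) v <= d.
  case: (pickP [pred w | (w \notin I) && (deg (edges H0) w < d)]) => [u /andP[uI ud]|no].
    apply: leq_trans (Hdeg u); rewrite -card_nbs -sum1_card [leqRHS]big_mkcond.
    rewrite [leqLHS]big_mkcond; apply: leq_sum => v _; case: ifP => // vI.
    rewrite -card_nbs inE; apply: leq_trans (_ : #|nbs (edges H) v :&: [set u]| <= _).
      apply/subset_leq_card/subsetP => w; rewrite !inE => vwH; rewrite vwH.
      by have /andP[wI wd] := nbI _ _ vI vwH; apply/eqP; exact: uniq_def.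
    case: ifP => [_|uv]; first by rewrite -(cards1 u) subset_leq_card// subsetIr.
    rewrite leqn0 cards_eq0; apply/eqP/setP => w; rewrite !inE.
    by apply/negbTE/negP => /andP[+ /eqP wu]; rewrite wu setUC uv.
  rewrite big1// => v vI; apply/eqP; rewrite -card_nbs cards_eq0.
  apply/eqP/setP => w; rewrite !inE; apply/negbTE/negP => vwH.
  by have := no w; rewrite /= (nbI _ _ vI vwH).
rewrite -(sum_deg (edges_pairs H)) (bigID [in I]) /=.
have : \sum_(v | v \notin I) deg (edges H) v <= d * #|~: I|.
  rewrite mulnC -sum_nat_const (eq_bigl (fun v => v \in ~: I)).
    by apply: leq_sum.
  by move=> v; rewrite inE.
rewrite -(cardsC I) mulnDr; move: sumI; lia.
Qed.

End NearFactor.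

From mathcomp Require Import all_order all_algebra reals.
From mathcomp Require Import ring lra.

Import Order.TTheory GRing.Theory Num.Theory.

(** * Union bounds in the random graph *)

Section RandomGraph.
Local Open Scope ring_scope.
Variables (R : realType) (p : R).
Hypothesis hp : 0 < p < 1.
Variable n : nat.
Implicit Types (A B : pred (sgraph 'I_n)) (T : {set {set 'I_n}}).

Lemma er_weight_ge0 (G : sgraph 'I_n) : 0 <= er_weight p G.
Proof. by apply: prodr_ge0 => e _; case: ifP => _; move: hp; lra. Qed.

Lemma er_prob_ge0 A : 0 <= er_prob p A.
Proof. by apply: sumr_ge0 => G _; exact: er_weight_ge0. Qed.

Lemma er_prob_mono A B : (forall G, A G -> B G) -> er_prob p A <= er_prob p B.
Proof.
move=> AB; rewrite /er_prob [leLHS]big_mkcond [leRHS]big_mkcond.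
apply: ler_sum => G _; have := AB G; have := er_weight_ge0 G.
by case: (A G); case: (B G) => // _ /(_ isT).
Qed.

Lemma er_prob_orb A B :
  er_prob p (fun G => A G || B G) <= er_prob p A + er_prob p B.
Proof.
rewrite /er_prob [X in _ <= X + _]big_mkcond [X in _ <= _ + X]big_mkcond.
rewrite -big_split [leLHS]big_mkcond; apply: ler_sum => G _ /=.
have := er_weight_ge0 G.
by case: (A G); case: (B G) => //=; lra.
Qed.

Lemma er_prob_compl A : er_prob p A = 1 - er_prob p (fun G => ~~ A G).
Proof.
rewrite -(er_prob_total p n) /er_prob [X in _ = X - _](bigID A) /=; lra.
Qed.

(** Expand the product of [F e + F' e] over all sets of edges: the factor is [1 - p] on [T] and 1
    elsewhere, and the terms that survive are the weights of the graphs avoiding [T]. *)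
Lemma er_prob_disjoint T : T \subset pairs 'I_n ->
  er_prob p (fun G : sgraph 'I_n => [disjoint edges G & T]) = (1 - p) ^+ #|T|.
Proof.
move=> /subsetP TP; rewrite /er_prob /er_weight.
rewrite (reindex_onto (@graph_of _) (@edges _)) /=; last first.
  by move=> G _; apply/val_inj/setIidPl/edges_pairs.
pose F (e : {set 'I_n}) := if (e \in pairs 'I_n) && (e \notin T) then p else 0.
pose F' (e : {set 'I_n}) := if e \in pairs 'I_n then 1 - p else 1.
have FF' : \prod_(e : {set 'I_n}) (F e + F' e) = (1 - p) ^+ #|T| :> R.
  rewrite -prodr_const [RHS]big_mkcond; apply: eq_bigr => e _; rewrite /F /F'.
  case: (boolP (e \in T)) => [/TP->|eT] /=; first by rewrite add0r.
  by rewrite andbT; case: ifP => _; lra.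
rewrite -[RHS]FF' bigA_distr [LHS]big_mkcond; apply: eq_big => //= E _.
case: ifP => [/andP[/pred0P ET /eqP EE]|].
  have /subsetP sE : E \subset pairs 'I_n by rewrite -EE; exact: subsetIr.
  rewrite [LHS]big_mkcond; apply: eq_big => //= e _.
  rewrite EE /F /F'; case: (boolP (e \in E)) => eE.
    by have := ET e; rewrite /= EE eE /= => ->; rewrite sE.
  by case: ifP.
move=> /negbT; rewrite negb_and => nE.
have [e eE ne] : exists2 e, e \in E & ~~ ((e \in pairs 'I_n) && (e \notin T)).
  case/orP: nE => [/pred0Pn[e /=]|EE].
    by rewrite inE => /andP[/andP[eE _] eT]; exists e; rewrite // eT andbF.
  have /subsetPn[e eE ne] : ~~ (E \subset pairs 'I_n).
    by apply: contra EE => /setIidPl ->.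
  by exists e; rewrite // (negbTE ne).
by rewrite (bigD1 e) //= eE /F (negbTE ne) mul0r.
Qed.

(** Union bound over encodings [i] of a bad configuration, where [T i] is a set of pairs that it
    forces to be non-edges. [Q] selects the meaningful encodings; the bound counts all of them. *)
Lemma er_prob_union (I : finType) (Q : pred I) (T : I -> {set {set 'I_n}})
    (t : nat) A :
  (forall i, Q i -> T i \subset pairs 'I_n /\ (t <= #|T i|)%N) ->
  (forall G, A G -> exists2 i, Q i & [disjoint edges G & T i]) ->
  er_prob p A <= #|I|%:R * (1 - p) ^+ t.
Proof.
move=> QT AT.
apply: (@le_trans _ _ (\sum_(i | Q i) er_prob p (fun G : sgraph 'I_n => [disjoint edges G & T i]))).
  rewrite /er_prob (exchange_big_dep predT) //= [leLHS]big_mkcond.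
  apply: ler_sum => G _; case: ifP => [/AT[i Qi Gi]|_].
    rewrite (bigD1 i) ?Qi//= lerDl; apply: sumr_ge0 => *; exact: er_weight_ge0.
  by apply: sumr_ge0 => *; exact: er_weight_ge0.
rewrite mulr_natl -sumr_const [leLHS]big_mkcond; apply: ler_sum => i _.
have q0 : 0 <= 1 - p by move: hp; lra.
case: ifP => [/QT[TP tT]|_]; last by rewrite exprn_ge0.
by rewrite er_prob_disjoint// ler_wiXn2l//; move: hp; lra.
Qed.

End RandomGraph.

(** * Bad events: sparse sets, pairs of sets without edges between them, low degrees *)

Section BadEvents.
Local Open Scope ring_scope.
Variables (R : realType) (p : R).
Hypothesis hp : 0 < p < 1.
Variable n : nat.

Lemma exists_enum_ffun (V : finType) (X : {set V}) k : #|X| = k ->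
  exists2 x : {ffun 'I_k -> V}, injective x & x @: setT = X.
Proof.
move=> <-; exists [ffun i => enum_val i].
  by move=> i j; rewrite !ffunE => /enum_val_inj.
apply/setP => v; apply/imsetP/idP => [[i _ ->]|vX].
  by rewrite ffunE enum_valP.
by exists (enum_rank_in vX v) => //; rewrite ffunE enum_rankK_in.
Qed.

Definition sparse_set (s d : nat) (G : sgraph 'I_n) :=
  [exists S : {set 'I_n}, (#|S| == s) &&
    [forall v in S, (#|nbs (edges G) v :&: S| <= d)%N]].

(* A set with induced degrees at most [d] is encoded by an enumeration [x] of
   it and, for each of its vertices, a list [g] of [d] possible neighbours; no
   pair outside these lists is an edge. *)
Lemma er_prob_sparse_set s d : er_prob p (sparse_set s d) <=
  (n ^ s * (s ^ d) ^ s)%:R * (1 - p) ^+ ('C(s, 2) - s * d).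
Proof.
pose I := ({ffun 'I_s -> 'I_n} * {ffun 'I_s -> {ffun 'I_d -> 'I_s}})%type.
pose P (i : I) := [set e : {set 'I_n} | e \subset i.1 @: setT & #|e| == 2].
pose L (i : I) := [set [set i.1 j.1; i.1 (i.2 j.1 j.2)] | j in [set: 'I_s * 'I_d]].
have -> : (n ^ s * (s ^ d) ^ s)%N = #|{: I}|.
  by rewrite card_prod !card_ffun !card_ord.
apply: (@er_prob_union _ _ hp _ _ (fun i : I => injectiveb i.1) (fun i => P i :\: L i)).
  move=> i /injectiveP inj; split.
    by apply/subsetP => e; rewrite !inE => /and3P[].
  have := cardsID (L i) (P i); have := subset_leq_card (subsetIr (P i) (L i)).
  have : #|P i| = 'C(s, 2).
    by rewrite cards_draws card_imset// cardsT card_ord.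
  have : (#|L i| <= s * d)%N.
    by apply: leq_trans (leq_imset_card _ _) _; rewrite cardsT card_prod !card_ord.
  by move: #|L i| #|P i| #|P i :&: L i| #|P i :\: L i| 'C(s, 2); clear; lia.
move=> G /existsP[S /andP[/eqP Ss /forall_inP Sd]].
have [x xI xS] := exists_enum_ffun Ss.
have inS v : v \in S -> exists i, v = x i.
  by rewrite -xS => /imsetP[i _ ->]; exists i.
have xin i : x i \in S by rewrite -xS imset_f.
pose nb i := enum (nbs (edges G) (x i) :&: S).
(* Lists shorter than [d] are padded with the vertex itself, which yields a singleton in [L] and so
   removes no pair from [P]. *)
pose g := [ffun i => [ffun a : 'I_d =>
  odflt i [pick j | x j == nth (x i) (nb i) a]]] : {ffun 'I_s -> {ffun 'I_d -> 'I_s}}.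
exists (x, g); first exact/injectiveP.
rewrite disjoint_subset; apply/subsetP => e eG; rewrite inE; apply/negP.
rewrite inE => /andP[/negP eL]; rewrite inE xS => /andP[eS e2]; apply: eL.
have [v ve] : exists v, v \in e by apply/card_gt0P; rewrite (eqP e2).
have [w vw eE] := edgeP eG ve.
have /inS[i vi] := subsetP eS _ ve; subst v.
have wS : w \in S by apply: (subsetP eS); rewrite eE set22.
have [j wj] := inS _ wS; subst w.
have jnb : x j \in nb i by rewrite mem_enum !inE -eE eG xin.
have ad : (index (x j) (nb i) < d)%N.
  apply: leq_trans (Sd _ (xin i)); rewrite cardE -/(nb i) index_mem.
  exact: jnb.
apply/imsetP; exists (i, Ordinal ad); first by rewrite inE.
rewrite /= eE !ffunE /=.
rewrite nth_index//; case: pickP => [j' /eqP <-//|/(_ j)].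
by rewrite eqxx.
Qed.

Definition empty_between (k : nat) (G : sgraph 'I_n) :=
  [exists X : {set 'I_n}, [exists Y : {set 'I_n},
    [&& #|X| == k, #|Y| == k, [disjoint X & Y] &
      [forall x in X, forall y in Y, [set x; y] \notin edges G]]]].

Lemma empty_betweenPn k G : ~~ empty_between k G -> edge_between G k.
Proof.
move=> + X Y Xk Yk XY; rewrite negb_exists => /forallP/(_ X).
rewrite negb_exists => /forallP/(_ Y); rewrite Xk Yk XY !eqxx /=.
rewrite negb_forall_in => /exists_inP[x xX]; rewrite negb_forall_in => /exists_inP[y yY].
by rewrite negbK; exists x, y.
Qed.

(** [X] and [Y] are encoded by enumerations; their disjointness makes the [k * k] forced non-edges
    distinct. *)
Lemma er_prob_empty_between k :
  er_prob p (empty_between k) <= (n ^ k * n ^ k)%:R * (1 - p) ^+ (k * k).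
Proof.
pose I := ({ffun 'I_k -> 'I_n} * {ffun 'I_k -> 'I_n})%type.
have -> : (n ^ k * n ^ k)%N = #|{: I}|.
  by rewrite card_prod !card_ffun !card_ord.
pose X (i : I) := i.1 @: [set: 'I_k]; pose Y (i : I) := i.2 @: [set: 'I_k].
apply: (@er_prob_union _ _ hp _ _
  (fun i : I => [&& #|X i| == k, #|Y i| == k & [disjoint X i & Y i]])
  (fun i => [set [set v.1; v.2] | v in setX (X i) (Y i)])).
  move=> i /and3P[/eqP Xk /eqP Yk XY].
  have XYn v w : v \in X i -> w \in Y i -> v != w.
    by move=> vX wY; apply: contraTneq wY => <-; rewrite (disjointFr XY).
  split.
    apply/subsetP => e /imsetP[[v w]]; rewrite inE => /andP[vX wY] ->.
    by rewrite pairs_set2 XYn.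
  rewrite card_in_imset ?cardsX ?Xk ?Yk// => -[v w] [v' w'] /=.
  rewrite !inE /= => /andP[vX wY] /andP[vX' wY'] /set2_eq[[-> ->//]|[vw _]].
  by move: (XYn _ _ vX wY'); rewrite vw eqxx.
move=> G /existsP[X0 /existsP[Y0 /and4P[/eqP Xk /eqP Yk XY /forall_inP GXY]]].
have [x _ xX] := exists_enum_ffun Xk; have [y _ yY] := exists_enum_ffun Yk.
exists (x, y); rewrite /X /Y /= xX yY ?Xk ?Yk ?eqxx//.
rewrite disjoint_sym disjoint_subset; apply/subsetP => e /imsetP[[v w]].
by rewrite inE /= => /andP[/GXY/forall_inP + wY] -> => /(_ _ wY); rewrite !inE.
Qed.

Definition low_degree (K : nat) (G : sgraph 'I_n) :=
  [exists v, (#|nbs (edges G) v| < K)%N].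

(** The encoding is a vertex with a list of [K] vertices covering its neighbours. All vertices off
    the list, except the vertex itself, are non-neighbours, which explains [K.+1]. *)
Lemma er_prob_low_degree K :
  er_prob p (low_degree K) <= (n * n ^ K)%:R * (1 - p) ^+ (n - K.+1).
Proof.
pose I := ('I_n * {ffun 'I_K -> 'I_n})%type.
have -> : (n * n ^ K)%N = #|{: I}|.
  by rewrite card_prod card_ffun !card_ord.
pose N (i : I) := i.1 |: i.2 @: [set: 'I_K].
apply: (@er_prob_union _ _ hp _ _ predT (fun i => [set [set i.1; w] | w in ~: N i])).
  move=> i _; split.
    apply/subsetP => _ /imsetP[w + ->]; rewrite pairs_set2 eq_sym.
    by rewrite !inE negb_or => /andP[].
  rewrite card_in_imset.
    have : (#|N i| <= K.+1)%N.
      rewrite cardsU1 -add1n leq_add ?leq_b1//.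
      by apply: leq_trans (leq_imset_card _ _) _; rewrite cardsT card_ord.
    by have := cardsC (N i); rewrite card_ord; move: #|N i| #|~: N i|; clear; lia.
  move=> w w'; rewrite !inE !negb_or => /andP[wi _] /andP[wi' _].
  by move=> /set2_eq[[]//|[e _]]; rewrite e eqxx in wi'.
move=> G /existsP[v vK].
pose y := [ffun a : 'I_K => nth v (enum (nbs (edges G) v)) a].
exists (v, y) => //; rewrite disjoint_sym disjoint_subset.
apply/subsetP => _ /imsetP[w + ->]; rewrite !inE /= negb_or => /andP[wv].
apply: contra => vw; have wnb : w \in enum (nbs (edges G) v) by rewrite mem_enum inE.
have aK : (index w (enum (nbs (edges G) v)) < K)%N.
  by apply: leq_trans vK; rewrite ltnS cardE ltnW// index_mem.
apply/imsetP; exists (Ordinal aK); first by rewrite inE.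
by rewrite ffunE /= nth_index.
Qed.

End BadEvents.

(** * Independent sets by the second moment method *)

Section SecondMoment.
Local Open Scope ring_scope.
Variables (R : realType) (p c : R).
Hypothesis hp : 0 < p < 1.
Hypotheses (c1 : 1 <= c) (cq : c ^+ 2 * (1 - p) = 1).
Variables n k m : nat.
Hypotheses (m0 : (0 < m)%N) (kmn : (k * m <= n)%N).

Definition independent_set (G : sgraph 'I_n) :=
  [exists S : {set 'I_n}, (#|S| == k) &&
    [forall v in S, forall w in S, [set v; w] \notin edges G]].

(** Vertex at position [z.2] of block [z.1]; only injectivity matters. *)
Let block_vertex (z : 'I_k * 'I_m) : 'I_n :=
  widen_ord (leq_trans (eq_leq (etrans (card_prod _ _)
    (f_equal2 muln (card_ord k) (card_ord m)))) kmn) (enum_rank z).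

Let block_vertex_inj : injective block_vertex.
Proof. by move=> z z' /(congr1 val)/= /ord_inj/enum_rank_inj. Qed.

Implicit Types x y : {ffun 'I_k -> 'I_m}.

(** Sets with one vertex in each block are used instead of all [k]-sets because the second moment
    then factors over the blocks. *)
Definition transversal_set x := [set block_vertex (i, x i) | i in [set: 'I_k]].

Definition transversal_pairs x :=
  [set e : {set 'I_n} | e \subset transversal_set x & #|e| == 2].

Lemma card_transversal_pairs x : #|transversal_pairs x| = 'C(k, 2).
Proof.
rewrite cards_draws card_imset ?cardsT ?card_ord// => i j.
by move=> /block_vertex_inj[].
Qed.

Lemma card_transversal_setI x y :
  #|transversal_set x :&: transversal_set y| = #|[set i | x i == y i]|.
Proof.
rewrite -(@card_imset _ _ (fun i => block_vertex (i, x i))); last first.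
  by move=> i j /block_vertex_inj[].
congr #|pred_of_set _|; apply/setP => v; rewrite inE; apply/andP/imsetP.
  move=> [/imsetP[i _ ->] /imsetP[j _ /block_vertex_inj[ij xy]]].
  by exists i => //; rewrite inE xy -ij.
by move=> [i]; rewrite inE => /eqP xy ->; split; apply/imsetP; exists i; rewrite ?inE ?xy.
Qed.

Lemma transversal_pairs_subset x : transversal_pairs x \subset pairs 'I_n.
Proof. by apply/subsetP => e; rewrite !inE => /andP[]. Qed.

Let q_gt0 : 0 < 1 - p. Proof. by move: hp; lra. Qed.

Let beta := c ^+ k.-1.

(** If [x] and [y] agree in [l] blocks, their sets share 'C(l, 2) pairs. Since [c] is a square root
    of [1 / (1 - p)], this costs a factor [c ^+ (l * l.-1)], at most [beta ^+ l], a product over the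
    blocks. *)
Lemma pair_probability x y :
  (1 - p) ^+ #|transversal_pairs x :|: transversal_pairs y| <=
  (1 - p) ^+ 'C(k, 2) * (1 - p) ^+ 'C(k, 2) *
    \prod_i (if x i == y i then beta else 1).
Proof.
pose l := #|[set i | x i == y i]|.
have IC : #|transversal_pairs x :&: transversal_pairs y| = 'C(l, 2).
  rewrite /l -card_transversal_setI -cards_draws; congr #|pred_of_set _|.
  apply/setP => e; rewrite !inE subsetI.
  by case: (e \subset _); case: (e \subset _); case: (#|e| == 2).
have cl : c ^+ (l * l.-1) * (1 - p) ^+ 'C(l, 2) = 1.
  have -> : (l * l.-1 = 2 * 'C(l, 2))%N by rewrite -mul_bin_diag bin1.
  by rewrite exprM -exprMn cq expr1n.
have UC : (1 - p) ^+ #|transversal_pairs x :|: transversal_pairs y|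
    * (1 - p) ^+ 'C(l, 2) = (1 - p) ^+ 'C(k, 2) * (1 - p) ^+ 'C(k, 2).
  rewrite -!exprD -IC; congr (_ ^+ _).
  by rewrite cardsUI !card_transversal_pairs.
rewrite -UC -mulrA; apply: ler_peMr; first by rewrite exprn_ge0 ?ltW.
rewrite -[leLHS]cl [leLHS]mulrC.
rewrite ler_wpM2l ?exprn_ge0 ?(ltW q_gt0)//.
rewrite -big_mkcond /= prodr_const -(_ : l = #|[pred i | x i == y i]|); last first.
  by rewrite /l cardsE.
rewrite /beta -exprM mulnC ler_weXn2l// leq_mul2r; apply/orP; right.
have : (l <= k)%N by rewrite -[leqRHS]card_ord max_card.
by clear; lia.
Qed.

(** For fixed [x] the sum over [y] is a product over the blocks; in each, one value of [y i] gives
    [beta] and the [m - 1] others give 1. *)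
Lemma sum_pair_probability :
  \sum_x \sum_y (1 - p) ^+ #|transversal_pairs x :|: transversal_pairs y| <=
  (m%:R ^+ k * (1 - p) ^+ 'C(k, 2)) * (1 - p) ^+ 'C(k, 2) * (m%:R + beta) ^+ k.
Proof.
have beta0 : 0 <= beta by rewrite exprn_ge0// (le_trans _ c1).
set Q := (1 - p) ^+ 'C(k, 2).
have -> : m%:R ^+ k * Q * Q * (m%:R + beta) ^+ k =
    \sum_(x : {ffun 'I_k -> 'I_m}) Q * Q * (m%:R + beta) ^+ k.
  rewrite sumr_const card_ffun !card_ord -[RHS]mulr_natl natrX; ring.
apply: ler_sum => x _.
apply: le_trans (ler_sum _ (fun y _ => pair_probability x y)) _.
rewrite -mulr_sumr ler_wpM2l ?mulr_ge0 ?exprn_ge0 ?(ltW q_gt0)//.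
rewrite -(bigA_distr_bigA (fun i j => if x i == j then beta else 1)) /=.
rewrite -[in leRHS](card_ord k) -prodr_const; apply: ler_prod => i _.
apply/andP; split; first by apply: sumr_ge0 => j _; case: ifP.
rewrite (bigD1 (x i)) //= eqxx addrC lerD2r.
rewrite (eq_bigr (fun=> 1)) => [|j]; last by rewrite eq_sym => /negbTE->.
rewrite sumr_const ler_nat; apply: leq_trans (max_card _) _.
by rewrite card_ord.
Qed.

(* Chebyshev's inequality for the number of independent transversals. *)
Lemma er_prob_no_independent_set :
  er_prob p (fun G => ~~ independent_set G) <= (1 + beta / m%:R) ^+ k - 1.
Proof.
pose X (G : sgraph 'I_n) : R :=
  \sum_x [disjoint edges G & transversal_pairs x]%:R.
pose mu : R := m%:R ^+ k * (1 - p) ^+ 'C(k, 2).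
have mu0 : 0 < mu by rewrite mulr_gt0 ?exprn_gt0 ?ltr0n.
have X0 G : ~~ independent_set G -> X G = 0.
  move=> nI; rewrite /X big1// => x _; case: (boolP [disjoint _ & _]) => // Gx.
  case/negP: nI; apply/existsP; exists (transversal_set x); apply/andP; split.
    by rewrite card_imset ?cardsT ?card_ord// => i j /block_vertex_inj[].
  apply/forall_inP => v vx; apply/forall_inP => w wx; apply/negP => vwG.
  have := disjointFr Gx vwG; rewrite inE cards2 (edge_neq vwG) eqxx andbT.
  by rewrite subUset !sub1set vx wx.
have EX : \sum_G er_weight p G * X G = mu.
  rewrite /X; under eq_bigr do rewrite mulr_sumr.
  rewrite exchange_big /= (eq_bigr (fun=> (1 - p) ^+ 'C(k, 2))).
    by rewrite sumr_const card_ffun !card_ord -[LHS]mulr_natl natrX.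
  move=> x _; rewrite -(card_transversal_pairs x).
  rewrite -er_prob_disjoint ?transversal_pairs_subset// /er_prob [RHS]big_mkcond.
  by apply: eq_bigr => G _; case: ifP => _; rewrite ?mulr1 ?mulr0.
have EX2 : \sum_G er_weight p G * X G ^+ 2 <=
    mu * (1 - p) ^+ 'C(k, 2) * (m%:R + beta) ^+ k.
  apply: le_trans sum_pair_probability; rewrite le_eqVlt; apply/orP; left; apply/eqP.
  have XX G : X G ^+ 2 = \sum_x \sum_y
      [disjoint edges G & transversal_pairs x :|: transversal_pairs y]%:R.
    rewrite expr2 /X mulr_suml; apply: eq_bigr => x _.
    rewrite mulr_sumr; apply: eq_bigr => y _.
    by rewrite -natrM mulnb !disjoints_subset setCU subsetI.
  under eq_bigr do rewrite XX mulr_sumr.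
  rewrite exchange_big /=; apply: eq_bigr => x _.
  under eq_bigr do rewrite mulr_sumr.
  rewrite exchange_big /=; apply: eq_bigr => y _.
  rewrite -er_prob_disjoint; last by rewrite subUset !transversal_pairs_subset.
  rewrite /er_prob [RHS]big_mkcond.
  by apply: eq_bigr => G _; case: ifP => _; rewrite ?mulr1 ?mulr0.
have mR0 : m%:R != 0 :> R by rewrite pnatr_eq0 -lt0n.
(* Without an independent [k]-set, [X G = 0] and the square equals 1, so it dominates the indicator
   of the event. *)
apply: (@le_trans _ _ (\sum_G er_weight p G * (X G / mu - 1) ^+ 2)).
  rewrite /er_prob [leLHS]big_mkcond; apply: ler_sum => G _.
  case: ifP => [/X0->|_]; last by rewrite mulr_ge0 ?er_weight_ge0 ?sqr_ge0.
  by rewrite mul0r sub0r sqrrN expr1n mulr1.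
have -> : \sum_G er_weight p G * (X G / mu - 1) ^+ 2 =
    (\sum_G er_weight p G * X G ^+ 2) / mu ^+ 2 - 1.
  have tot : \sum_(G : sgraph 'I_n) er_weight p G = 1 by exact: er_prob_total.
  transitivity (\sum_G (er_weight p G * X G ^+ 2 / mu ^+ 2
      - 2 / mu * (er_weight p G * X G) + er_weight p G)).
    by apply: eq_bigr => G _; field; rewrite gt_eqF.
  rewrite big_split /= tot sumrB -mulr_suml -mulr_sumr EX.
  by field; rewrite gt_eqF.
rewrite lerD2r ler_pdivrMr ?exprn_gt0//; apply: le_trans EX2 _.
have -> : 1 + beta / m%:R = (m%:R + beta) / m%:R by field.
rewrite expr_div_n /mu.
have mk0 : m%:R ^+ k != 0 :> R by rewrite expf_neq0.
by rewrite le_eqVlt; apply/orP; left; apply/eqP; field.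
Qed.

End SecondMoment.

(** Deterministic core: the four events give the hypotheses of [saturated_star_card_ge] and
    [sat_star_le]. The bound [d.-1] turns non-sparseness into a vertex with at least [d] neighbours
    in the set. *)
Lemma sat_star_bounds n (G : sgraph 'I_n) d s k k' : (0 < d)%N ->
  ~~ sparse_set s d.-1 G -> ~~ empty_between k' G ->
  ~~ low_degree (d + k + d * ((d + 2) * k')) G -> independent_set k G ->
  (d * n <= 2 * sat G (star d.+1) + d * s)%N /\
  (2 * sat G (star d.+1) + d * k <= d * n + d)%N.
Proof.
move=> d0 nsparse /empty_betweenPn Gk nlow /existsP[S /andP[/eqP Sk /forall_inP indS]].
split.
  have ex : exists H, saturated G (star d.+1) H.
    by apply: saturated_exists; rewrite card_star.
  have [[H sH <-] _] := Defs.satP ex; rewrite -[X in (_ * X <= _)%N](card_ord n).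
  apply: saturated_star_card_ge sH _ => X Xs.
  move: nsparse; rewrite negb_exists => /forallP/(_ X); rewrite Xs eqxx /=.
  rewrite negb_forall_in => /exists_inP[v vX]; rewrite -ltnNge prednK//.
  by exists v.
rewrite -Sk -[X in (_ <= _ * X + _)%N](card_ord n).
apply: (sat_star_le d0 Gk) => [w|v w vS wS].
  by rewrite Sk leqNgt; move: nlow; rewrite negb_exists => /forallP/(_ w).
by move/forall_inP: (indS _ vS) => /(_ _ wS).
Qed.

From mathcomp Require Import all_classical all_reals all_analysis.

Import numFieldNormedType.Exports.
Local Open Scope classical_set_scope.
Local Open Scope ring_scope.

(** * Asymptotics *)

Section Asymptotics.
Variable R : realType.
Implicit Types (C a : R) (n : nat).

Lemma near_ln_ge C : \forall n \near \oo, C <= ln n%:R.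
Proof.
near=> n.
rewrite -[C]expRK ler_ln ?posrE ?expR_gt0//; first by near: n; exact: nbhs_infty_ger.
by near: n; exact: nbhs_infty_gtr.
Unshelve. all: by end_near. Qed.

Lemma near_expR_ln : \forall n \near \oo, expR (ln n%:R) = n%:R :> R.
Proof. by near=> n; rewrite lnK// posrE; near: n; exact: nbhs_infty_gtr.
Unshelve. all: by end_near. Qed.

(** The term of degree [e.+1] of the exponential series suffices: its extra factor [ln n%:R] absorbs
    all constants. *)
Lemma near_ln_pow_le C a e : 0 < a ->
  \forall n \near \oo, C * ln n%:R ^+ e <= expR (a * ln n%:R).
Proof.
move=> a0; near=> n.
have l0 : 0 <= ln n%:R :> R by near: n; exact: near_ln_ge.
have lC : C * e.+1`!%:R / a ^+ e.+1 <= ln n%:R by near: n; exact: near_ln_ge.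
have := expR_ge1Dxn e (mulr_ge0 (ltW a0) l0); apply: le_trans.
apply: (@le_trans _ _ ((a * ln n%:R) ^+ e.+1 / (e.+1)`!%:R)); last by rewrite lerDr.
rewrite ler_pdivlMr ?ltr0n ?fact_gt0// exprMn exprS -mulrA mulrC.
rewrite ler_pdivrMr ?exprn_gt0// in lC.
rewrite [ln _ ^+ e.+1]exprS.
have := ler_wpM2r (exprn_ge0 e l0) lC.
rewrite exprS; lra.
Unshelve. all: by end_near. Qed.

Lemma expR_le_delta (x delta : R) : 0 < delta -> x <= ln delta -> expR x <= delta.
Proof. by move=> d0 xd; rewrite -[leRHS]lnK ?posrE// ler_expR. Qed.

Lemma expRX_le (x : R) s : x <= 0 -> (0 < s)%N -> expR x ^+ s <= expR x.
Proof.
move=> x0; case: s => // s _; rewrite exprS ler_piMr ?expR_ge0//.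
by rewrite exprn_ile1 ?expR_ge0// -expR0 ler_expR.
Qed.

End Asymptotics.

(** * Sets of logarithmic size, and bad events of vanishing probability *)

Section Thresholds.
Variables (R : realType) (p : R).
Hypothesis hp : 0 < p < 1.

Let lam := - ln (1 - p).

Let lam_gt0 : 0 < lam.
Proof. by rewrite oppr_gt0 ln_lt0//; move: hp; lra. Qed.

Let one_minus_p : 1 - p = expR (- lam).
Proof. by rewrite opprK lnK// posrE; move: hp; lra. Qed.

(** As [lam] is the logarithm of [1 / (1 - p)], this is [a] times the logarithm of [n] in that base,
    rounded so that it is always positive and, for [a >= 0] and large [n], not below that value. *)
Definition log_size (a : R) n := (Num.truncn (a * (ln n%:R / lam))).+1.

Lemma log_size_bounds a : 0 <= a -> \forall n \near \oo,
  a * ln n%:R <= lam * (log_size a n)%:R <= a * ln n%:R + lam.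
Proof.
move=> a0; near=> n.
have l0 : 0 <= ln n%:R :> R by near: n; exact: near_ln_ge.
have x0 : 0 <= a * (ln n%:R / lam) by rewrite mulr_ge0// divr_ge0// ltW.
have /andP[le1 le2] := truncn_itv x0.
have -> : a * ln n%:R = lam * (a * (ln n%:R / lam)) by field; rewrite gt_eqF.
apply/andP; split; first by rewrite ler_pM2l// ltW.
by rewrite /log_size -natr1 mulrDr mulr1 lerD2r ler_pM2l.
Unshelve. all: by end_near. Qed.

Lemma log_size_le_ln a : 0 <= a -> exists C : R, 0 <= C /\
  \forall n \near \oo, (log_size a n)%:R <= C * ln n%:R.
Proof.
(* The added 1 absorbs the rounding error, as [lam <= ln n%:R] eventually. *)
move=> a0; exists ((a + 1) / lam); split.
  by rewrite divr_ge0 ?ltW//; lra.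
near=> n.
have /andP[_] : a * ln n%:R <= lam * (log_size a n)%:R <= a * ln n%:R + lam.
  by near: n; exact: log_size_bounds.
have : lam <= ln n%:R by near: n; exact: near_ln_ge.
by move=> lam_le s_le; rewrite mulrAC ler_pdivlMr//; lra.
Unshelve. all: by end_near. Qed.

Lemma near_sparse_set (eps delta : R) d : 0 < eps -> 0 < delta ->
  \forall n \near \oo,
    er_prob p (sparse_set (n:=n) (log_size (2 + eps) n) d) <= delta.
Proof.
move=> eps0 delta0.
have [C [C0 nearC]] : exists C : R, 0 <= C /\
    \forall n \near \oo, (log_size (2 + eps) n)%:R <= C * ln n%:R.
  by apply: log_size_le_ln; lra.
near=> n.
apply: le_trans (er_prob_sparse_set hp _ _ _) _.
have l1 : 1 <= ln n%:R :> R by near: n; exact: near_ln_ge.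
have ld : lam * (2 * d)%:R <= ln n%:R by near: n; exact: near_ln_ge.
have sC : (log_size (2 + eps) n)%:R <= C * ln n%:R by near: n.
have /andP[s1 _] : (2 + eps) * ln n%:R <= lam * (log_size (2 + eps) n)%:R <=
    (2 + eps) * ln n%:R + lam.
  by near: n; apply: log_size_bounds; lra.
have nl : expR (ln n%:R) = n%:R :> R by near: n; exact: near_expR_ln.
have pC : C ^+ d * ln n%:R ^+ d <= expR (eps / 4 * ln n%:R).
  by near: n; apply: near_ln_pow_le; lra.
have big : (lam / 2 + lam * d%:R + `|ln delta|) / (eps / 4) <= ln n%:R.
  by near: n; exact: near_ln_ge.
set (l := ln n%:R) in *; set (s := log_size (2 + eps) n) in *.
(* Makes the truncated subtraction in the exponent ['C(s, 2) - s * d] an exact one. *)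
have sd : (2 * d < s)%N.
  rewrite -(ltr_nat R) -(ltr_pM2l lam_gt0); apply: lt_le_trans s1.
  nra.
have pl : (s ^ d)%:R <= expR (eps / 4 * l).
  rewrite natrX; apply: le_trans pC; rewrite -exprMn lerXn2r ?nnegrE//.
  by rewrite (le_trans _ sC).
(* The bound is at most [expR y ^+ s]: each vertex costs [l], its list [eps / 4 * l], and its
   non-edges gain the last term. As [lam * s] is at least [(2 + eps) * l], [y] is at most
   [- (eps / 4) * l] plus a constant. *)
pose y := l + eps / 4 * l - lam * ((s%:R - 1) / 2 - d%:R).
have yle : y <= - (eps / 4) * l + lam / 2 + lam * d%:R by rewrite /y; nra.
have ey : expR y ^+ s <= delta.
  rewrite ler_pdivrMr in big; last by lra.
  have := ler_norm (ln delta); have := ler_norm (- ln delta).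
  rewrite normrN => n1 n2.
  apply: le_trans (expRX_le _ _) _ => //; first by lra.
  by apply: expR_le_delta => //; lra.
apply: le_trans ey.
have -> : (1 - p) ^+ ('C(s, 2) - s * d) = expR (- lam * ((s%:R - 1) / 2 - d%:R)) ^+ s.
  rewrite one_minus_p -!expRM_natl; congr expR.
  have C2 : ('C(s, 2) * 2 = s * s.-1)%N by rewrite mulnC -mul_bin_diag bin1.
  rewrite natrB; last by move: C2 sd; clear; nia.
  have : ('C(s, 2)%:R * 2 = s%:R * (s%:R - 1) :> R).
    by rewrite -[2]/(2%:R) -natrM C2 natrM -subn1 natrB.
  rewrite natrM => e2; have -> : 'C(s, 2)%:R = s%:R * (s%:R - 1) / 2 :> R by lra.
  by field.
have -> : expR y ^+ s = expR l ^+ s * expR (eps / 4 * l) ^+ s *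
    expR (- lam * ((s%:R - 1) / 2 - d%:R)) ^+ s.
  by rewrite -!exprMn -!expRD; congr (expR _ ^+ _); rewrite /y; ring.
rewrite natrM nl !natrX ler_wpM2r ?exprn_ge0 ?expR_ge0//.
rewrite ler_wpM2l ?exprn_ge0//.
by rewrite lerXn2r ?nnegrE ?expR_ge0// -natrX.
Unshelve. all: by end_near. Qed.

(** The bound is the [k]-th power of [n ^ 2 * (1 - p) ^ k], which is at most [1 / n] when [lam * k]
    is at least [3 * ln n]. *)
Lemma near_empty_between (delta : R) : 0 < delta ->
  \forall n \near \oo, er_prob p (empty_between (n:=n) (log_size 3 n)) <= delta.
Proof.
move=> delta0; near=> n.
apply: le_trans (er_prob_empty_between hp _ _) _.
have l0 : 0 <= ln n%:R :> R by near: n; exact: near_ln_ge.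
have lD : - ln delta <= ln n%:R by near: n; exact: near_ln_ge.
have /andP[k1 _] : 3 * ln n%:R <= lam * (log_size 3 n)%:R <= 3 * ln n%:R + lam.
  by near: n; exact: log_size_bounds.
have nl : expR (ln n%:R) = n%:R :> R by near: n; exact: near_expR_ln.
set (l := ln n%:R) in *; set (k := log_size 3 n) in *.
rewrite natrM !natrX -nl exprM one_minus_p -!exprMn -expRM_natr -!expRD.
have y0 : l + l + - lam * k%:R <= - l by lra.
apply: le_trans (expRX_le _ _) _ => //; first by lra.
by apply: expR_le_delta => //; lra.
Unshelve. all: by end_near. Qed.

Lemma near_low_degree (K : nat -> nat) (C delta : R) : 0 < delta -> 0 <= C ->
  (\forall n \near \oo, (K n)%:R <= C * ln n%:R) ->
  \forall n \near \oo, er_prob p (low_degree (n:=n) (K n)) <= delta.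
Proof.
move=> delta0 C0 KC; near=> n.
apply: le_trans (er_prob_low_degree hp _ _) _.
have l1 : 1 <= ln n%:R :> R by near: n; exact: near_ln_ge.
have lD : - ln delta <= ln n%:R by near: n; exact: near_ln_ge.
have kC : (K n)%:R <= C * ln n%:R by near: n.
have nl : expR (ln n%:R) = n%:R :> R by near: n; exact: near_expR_ln.
(* The three summands pay for the number of encodings, for the [K.+1] pairs missing from the
   exponent, and for [delta]. *)
have nM : ((C + 1) + lam * (C + 1) + 1) / lam * ln n%:R ^+ 2 <= expR (1 * ln n%:R).
  by near: n; exact: near_ln_pow_le.
have nk : (C + 1) * ln n%:R ^+ 1 <= expR (1 * ln n%:R).
  by near: n; exact: near_ln_pow_le.
set (l := ln n%:R) in *; set (k := K n) in *.
rewrite mul1r nl in nM nk.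
have kn : (k.+1 <= n)%N by rewrite -(ler_nat R) -natr1; move: nk; rewrite expr1; nra.
rewrite natrM natrX one_minus_p -nl -exprS -!expRM_natl -expRD.
apply: expR_le_delta => //; rewrite natrB// -!natr1.
have nM' : ((C + 1) + lam * (C + 1) + 1) * l ^+ 2 <= lam * n%:R.
  by rewrite mulrAC ler_pdivrMr// [n%:R * _]mulrC in nM.
have kl : (k%:R + 1) * l <= (C + 1) * l ^+ 2.
  by rewrite expr2 mulrA ler_wpM2r//; nra.
have ll : l <= l ^+ 2 by nra.
have kl2 : lam * (k%:R + 1) <= lam * ((C + 1) * l ^+ 2).
  rewrite ler_wpM2l ?(ltW lam_gt0)//.
  by apply: (@le_trans _ _ ((C + 1) * l)); [|rewrite ler_wpM2l//]; lra.
move: nM' kl kl2 lD ll; rewrite !mulrDl !mulrDr; lra.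
Unshelve. all: by end_near. Qed.

(** With [k = j.+1], [beta = c ^+ j] is of order at most [n] to the power [1 - eps], while [m] is
    about [n / k]; so [k * beta / m] tends to 0. *)
Lemma near_no_independent_set (eps delta : R) : 0 < eps < 1 -> 0 < delta ->
  \forall n \near \oo, er_prob p (fun G =>
    ~~ @independent_set n (log_size (2 - 2 * eps) n).+1 G) <= delta.
Proof.
move=> eps01 delta0.
have [C [C0 nearC]] : exists C : R, 0 <= C /\
    \forall n \near \oo, (log_size (2 - 2 * eps) n)%:R <= C * ln n%:R.
  by apply: log_size_le_ln; lra.
near=> n.
have l1 : 1 <= ln n%:R :> R by near: n; exact: near_ln_ge.
have jC : (log_size (2 - 2 * eps) n)%:R <= C * ln n%:R by near: n.
have /andP[_ j2] : (2 - 2 * eps) * ln n%:R <=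
    lam * (log_size (2 - 2 * eps) n)%:R <= (2 - 2 * eps) * ln n%:R + lam.
  by near: n; apply: log_size_bounds; lra.
have nl : expR (ln n%:R) = n%:R :> R by near: n; exact: near_expR_ln.
have nC : (C + 1) * ln n%:R ^+ 1 <= expR (1 * ln n%:R).
  by near: n; exact: near_ln_pow_le.
(* Since [1 + x <= expR x], it suffices that [k * beta / m] be at most this logarithm. *)
have eta0 : 0 < ln (delta + 1) by apply: ln_gt0; lra.
have pl : 2 * (C + 1) ^+ 2 * expR (lam / 2) / ln (delta + 1) * ln n%:R ^+ 2 <=
    expR (eps * ln n%:R).
  by near: n; apply: near_ln_pow_le; case/andP: eps01.
set (l := ln n%:R) in *; set (j := log_size (2 - 2 * eps) n) in *.
set (eta := ln (delta + 1)) in *.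
rewrite mul1r expr1 nl in nC.
have kC : j.+1%:R <= (C + 1) * l by rewrite -natr1; nra.
have kn : (j.+1 <= n)%N by rewrite -(ler_nat R) (le_trans kC).
pose c := expR (lam / 2).
have c1 : 1 <= c by rewrite -expR0 ler_expR; move: lam_gt0; lra.
have cq : c ^+ 2 * (1 - p) = 1.
  by rewrite one_minus_p -expRM_natl -expRD -[RHS]expR0; congr expR; field.
have m0 : (0 < n %/ j.+1)%N by rewrite divn_gt0.
have kmn : (j.+1 * (n %/ j.+1) <= n)%N by rewrite mulnC leq_trunc_div.
apply: le_trans (er_prob_no_independent_set hp c1 cq m0 kmn) _.
set m := (n %/ j.+1)%N in m0 kmn *; rewrite /=.
have mR : 0 < m%:R :> R by rewrite ltr0n.
(* Rounding down to [m >= 1] loses at most a factor 2. *)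
have n2m : n%:R <= 2 * j.+1%:R * m%:R :> R.
  rewrite -!natrM ler_nat; have := ltn_ceil n (ltn0Sn j); rewrite -/m.
  by move: m0; clear; nia.
rewrite lerBlDr.
apply: (@le_trans _ _ (expR (c ^+ j / m%:R) ^+ j.+1)).
  rewrite lerXn2r ?nnegrE ?expR_ge0 ?expR_ge1Dx//.
  by rewrite addr_ge0// divr_ge0 ?exprn_ge0 ?expR_ge0// ltW.
rewrite -expRM_natl; apply: expR_le_delta; first by lra.
rewrite mulrA ler_pdivrMr//.
have cj : c ^+ j <= expR ((1 - eps) * l + lam / 2).
  by rewrite -expRM_natl ler_expR; lra.
have pl2 : 2 * (C + 1) ^+ 2 * expR (lam / 2) * l ^+ 2 <= eta * expR (eps * l).
  by rewrite mulrAC ler_pdivrMr// [_ * eta]mulrC in pl.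
have k2 : j.+1%:R ^+ 2 <= ((C + 1) * l) ^+ 2.
  by rewrite lerXn2r ?nnegrE// (le_trans _ kC).
have k0 : 0 < j.+1%:R :> R by rewrite ltr0n.
rewrite -(ler_pM2l (_ : 0 < 2 * j.+1%:R)); last by rewrite mulr_gt0.
apply: (@le_trans _ _ (eta * n%:R)); last first.
  by rewrite [leRHS]mulrCA ler_pM2l.
apply: (@le_trans _ _ (2 * ((C + 1) * l) ^+ 2 * expR ((1 - eps) * l + lam / 2))).
  rewrite [leLHS](_ : _ = 2 * j.+1%:R ^+ 2 * c ^+ j); last by rewrite expr2 !mulrA.
  by apply: ler_pM; rewrite ?mulr_ge0 ?exprn_ge0 ?expR_ge0 ?ler_pM2l.
rewrite expRD -nl (_ : expR l = expR (eps * l) * expR ((1 - eps) * l)); last first.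
  by rewrite -expRD; congr expR; lra.
rewrite mulrA -(ler_pM2r (expR_gt0 ((1 - eps) * l))) in pl2.
by move: pl2; rewrite exprMn; clear; lra.
Unshelve. all: by end_near. Qed.

End Thresholds.

Theorem theorem6 (R : realType) (p : R) (r : nat) (hp : 0 < p < 1)
    (hr : (2 <= r)%N) :
  let b : R := 1 / (1 - p) in
  forall eps : R, 0 < eps ->
  (fun n : nat => er_prob p (fun G : sgraph 'I_n =>
     (r%:R - 1) * n%:R / 2 - (1 + eps) * (r%:R - 1) * log_base b n%:R
       <= (sat G (star r))%:R
       <= (r%:R - 1) * n%:R / 2 - (1 - eps) * (r%:R - 1) * log_base b n%:R))
  @ \oo --> (1 : R).
Proof.
move=> b eps eps0.
have [d d0 ->] : exists2 d, (0 < d)%N & r = d.+1.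
  by exists r.-1; move: hr; case: (r) => [|[]].
have rd : d.+1%:R - 1 = d%:R :> R by rewrite -natr1 addrK.
have q0 : 0 < 1 - p by move: hp; lra.
have lamb : ln b = - ln (1 - p) by rewrite /b div1r lnV ?posrE.
have lam0 : 0 < - ln (1 - p) by rewrite oppr_gt0 ln_lt0//; move: hp; lra.
(* Replacing [eps] by a smaller [e] strengthens the upper bound and keeps the size of the
   independent set positive. *)
have [e [e01 e_eps]] : exists e, 0 < e < 1 /\ e <= eps.
  by exists (Num.min eps (1 / 2)); rewrite lt_min gt_min ge_min lexx eps0; split; lra.
have e2 : 0 <= 2 - 2 * e by move: e01; lra.
(* The additional vertex cancels the summand [d] on the right of the upper bound in
   [sat_star_bounds]. *)
pose k n := (log_size p (2 - 2 * e) n).+1.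
pose K n := (d + k n + d * ((d + 2) * log_size p 3 n))%N.
have [C1 [C10 kC1]] := log_size_le_ln hp e2.
have [C2 [C20 kC2]] := log_size_le_ln hp (ler0n R 3).
pose C : R := d%:R + 1 + C1 + d%:R * (d + 2)%:R * C2.
have C0 : 0 <= C by rewrite !addr_ge0 ?mulr_ge0.
have KC : \forall n \near \oo, (K n)%:R <= C * ln n%:R.
  near=> n.
  have l1 : 1 <= ln n%:R :> R by near: n; exact: near_ln_ge.
  have h1 : (log_size p (2 - 2 * e) n)%:R <= C1 * ln n%:R by near: n.
  have h2 : (log_size p 3 n)%:R <= C2 * ln n%:R by near: n.
  have hd := ler_peMr (ler0n R d) l1.
  have h3 : (d * ((d + 2) * log_size p 3 n))%:R <=
      d%:R * (d + 2)%:R * C2 * ln n%:R :> R.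
    by rewrite !natrM -!mulrA !ler_wpM2l.
  rewrite /K /k natrD natrD -natr1 /C.
  by move: l1 h1 h3 hd; clear; lra.
apply/cvgrPdist_le => delta delta0.
have delta4 : 0 < delta / 4 by lra.
near=> n.
rewrite er_prob_compl opprB addrC subrK ger0_norm ?er_prob_ge0//.
have b1 : er_prob p (sparse_set (n:=n) (log_size p (2 + eps) n) d.-1) <= delta / 4.
  by near: n; exact: (near_sparse_set hp d.-1 eps0 delta4).
have b2 : er_prob p (empty_between (n:=n) (log_size p 3 n)) <= delta / 4.
  by near: n; exact: (near_empty_between hp delta4).
have b3 : er_prob p (low_degree (n:=n) (K n)) <= delta / 4.
  by near: n; exact: (near_low_degree hp delta4 C0 KC).
have b4 : er_prob p (fun G => ~~ @independent_set n (k n) G) <= delta / 4.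
  by near: n; exact: (near_no_independent_set hp e01 delta4).
have l0 : 0 <= ln n%:R :> R by near: n; exact: near_ln_ge.
(* The rounding error in [s] is at most [eps * ln n%:R], which takes [2 + eps] to the required
   [2 + 2 * eps]. *)
have le : - ln (1 - p) / eps <= ln n%:R by near: n; exact: near_ln_ge.
have /andP[_ hs] : (2 + eps) * ln n%:R <=
    - ln (1 - p) * (log_size p (2 + eps) n)%:R <= (2 + eps) * ln n%:R - ln (1 - p).
  by near: n; apply: log_size_bounds => //; lra.
have /andP[hk _] : (2 - 2 * e) * ln n%:R <=
    - ln (1 - p) * (log_size p (2 - 2 * e) n)%:R <= (2 - 2 * e) * ln n%:R - ln (1 - p).
  by near: n; exact: log_size_bounds.
apply: (@le_trans _ _ (delta / 4 + (delta / 4 + (delta / 4 + delta / 4)))); last by lra.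
apply: le_trans (lerD b1 (lerD b2 (lerD b3 b4))).
apply: le_trans (lerD (lexx _) (lerD (lexx _) (er_prob_orb hp _ _))).
apply: le_trans (lerD (lexx _) (er_prob_orb hp _ _)).
apply: le_trans (er_prob_orb hp _ _).
apply: er_prob_mono => // G; apply: contraR; rewrite !negb_or negbK.
move=> /and4P[n1 n2 n3 n4].
have [] := sat_star_bounds d0 n1 n2 n3 n4.
rewrite -!(ler_nat R) !natrD !natrM => lo hi; rewrite rd /log_base lamb.
set (lam := - ln (1 - p)) in *.
set s := (log_size p (2 + eps) n)%:R in hs lo.
set L := ln n%:R / lam.
have lL : ln n%:R = L * lam by rewrite divfK // gt_eqF.
have ds : d%:R * s <= d%:R * ((2 + 2 * eps) * L).
  rewrite ler_wpM2l // -(ler_pM2l lam0).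
  by move: hs le; rewrite ler_pdivrMr // lL; clear; lra.
have dk : d%:R * ((2 - 2 * eps) * L) <= d%:R * (log_size p (2 - 2 * e) n)%:R.
  rewrite ler_wpM2l // -(ler_pM2l lam0); apply: le_trans hk.
  rewrite lL [leLHS]mulrC -mulrA ler_wpM2r // -?lL //.
  by have := e_eps; lra.
by move: lo hi ds dk; rewrite /k -natr1; clear; lra.
Unshelve. all: by end_near. Qed.
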